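(* There exists an absolute constant $C>0$ such that for every integer $n\ge 1$, \[ s(n)\le \frac{14}{3}\,n\log_3 n+Cn, \] where $s(n)$ denotes the minimum number of edges of an $n$-vertex graph that contains every $n$-vertex tree as a subgraph.
   Context: Graphs are finite and simple. A graph $G$ contains $H$ as a subgraph if $G$ has a (not necessarily induced) subgraph isomorphic to $H$. The number $s(n)$ is the minimum of $e(G)$ over all graphs $G$ on exactly $n$ vertices such that every tree on $n$ vertices is isomorphic to a (necessarily spanning) subgraph of $G$. *)

(* Defs.v *)
From HB Require Import structures.
From mathcomp Require Import all_boot all_order all_algebra.
From mathcomp Require Import boolp reals exp.

Set Implicit Arguments.
Unset Strict Implicit.
Unset Printing Implicit Defensive.

Import Order.TTheory GRing.Theory Num.Theory.

Record sgraph (V : finType) := SGraph {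
  adj : rel V;
  adj_sym : symmetric adj;
  adj_irr : irreflexive adj
}.

Definition edges (V : finType) (G : sgraph V) : {set {set V}} :=
  [set [set p.1; p.2] | p in [set q : V * V | adj G q.1 q.2]].

Definition num_edges (V : finType) (G : sgraph V) : nat := #|edges G|.

(* [ucycle] accepts cycles of length 2 (an edge traversed back and forth),
   which are not cycles of a simple graph. *)
Definition acyclic (V : finType) (G : sgraph V) : Prop :=
  forall c : seq V, ucycle (adj G) c -> size c < 3.

Definition connected (V : finType) (G : sgraph V) : Prop :=
  0 < #|V| /\ forall x y : V, connect (adj G) x y.

Definition is_tree (V : finType) (G : sgraph V) : Prop :=
  connected G /\ acyclic G.

Definition contains (V W : finType) (G : sgraph V) (H : sgraph W) : Prop :=
  exists f : W -> V,
    injective f /\ forall x y : W, adj H x y -> adj G (f x) (f y).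

Definition tree_universal (n : nat) (V : finType) (G : sgraph V) : Prop :=
  #|V| = n /\
  forall (W : finType) (T : sgraph W), #|W| = n -> is_tree T -> contains G T.

Definition universal_size (n m : nat) : Prop :=
  exists (V : finType) (G : sgraph V), tree_universal n G /\ num_edges G = m.

Section Complete.
Variable V : finType.

Fact complete_sym : symmetric (fun x y : V => x != y).
Proof. by move=> x y; rewrite eq_sym. Qed.

Fact complete_irr : irreflexive (fun x y : V => x != y).
Proof. by move=> x; rewrite eqxx. Qed.

Definition complete : sgraph V := SGraph complete_sym complete_irr.
End Complete.

Lemma complete_universal (n : nat) : tree_universal n (complete 'I_n).
Proof.
split=> [|W T cardW _]; first exact: card_ord.
exists (fun x => cast_ord cardW (enum_rank x)); split.
  by move=> x y /cast_ord_inj /enum_rank_inj.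
move=> x y /= Txy; rewrite (inj_eq (@cast_ord_inj _ _ _)).
rewrite (inj_eq enum_rank_inj).
by apply/eqP=> xy; rewrite xy adj_irr in Txy.
Qed.

Lemma universal_size_ex (n : nat) : exists m, `[< universal_size n m >].
Proof.
exists (num_edges (complete 'I_n)); apply/asboolP.
by exists 'I_n, (complete 'I_n); split=> //; exact: complete_universal.
Qed.

Definition s (n : nat) : nat := ex_minn (universal_size_ex n).

Definition log3 (R : realType) (x : R) : R := (ln x / ln 3%:R)%R.

(* Main.v *)
Require Import Defs.
From HB Require Import structures.
From mathcomp Require Import all_boot all_order all_algebra.
From mathcomp Require Import boolp reals exp.
From mathcomp Require Import zify lra.

Set Implicit Arguments.
Unset Strict Implicit.
Unset Printing Implicit Defensive.

Import Order.TTheory GRing.Theory Num.Theory.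

(** The host graph lives on the positions [0, ..., n-1]: the position
    [(2k+1) * 2^i] is joined to everything within distance [3 * 2^i + 3] ("strong",
    [k] even) or [2 * 2^i + 3] ("weak", [k] odd).  This costs [5n/2] edges per
    scale [i], hence [(5/2) n log_2 n + O(n)] edges, and [5/2 < (14/3) log_3 2].

    A tree is embedded by repeatedly putting a separating vertex on a position
    that reaches every free position of the tree's interval, and packing the
    remaining components into consecutive chunks.  At scale [u = 2h] all
    non-multiples of [u] in the interval are still free, and the tree has at most
    [3u/2] vertices or its interval lies strictly between [(k-1)u] and [(k+1)u].
    - If the tree has at most [3u/2] vertices, a centroid goes on an odd multiple
      of [h], strong if there is one; the halves fit scale [h].  If the interval
      contains no odd multiple of [h], it lies around a multiple of [u] and scale
      [h] applies at once.
    - Otherwise cut at a vertex whose removal leaves pieces of at most [3u/4]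
      vertices and one remainder, and put it on the strong one of [ku - h] and
      [ku + h], which reaches the whole interval.  A remainder that is still too
      large is packed at the weak end, where the weak position reaches all of it,
      and is halved by a centroid placed there. *)

(** * Rooted trees and cutting them at a vertex *)

(* Rooted trees spanned by [e], as vertex lists; [rtree_join] hangs a subtree
   rooted at [z] below the root [x]. *)
Inductive rtree (W : eqType) (e : rel W) : W -> seq W -> Prop :=
| rtree1 x : rtree e x [:: x]
| rtree_join x A z B : rtree e x A -> rtree e z B -> e x z -> uniq (A ++ B) ->
    (forall a b, a \in A -> b \in B -> e a b -> a = x /\ b = z) ->
    rtree e x (A ++ B).

Definition sep (W : eqType) (e : rel W) : rel (seq W) :=
  allrel (fun a b => ~~ e a b).

Definition subtree (W : eqType) (e : rel W) (A : seq W) : Prop :=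
  A = [::] \/ exists x, rtree e x A.

Lemma sepP (W : eqType) (e : rel W) (A B : seq W) :
  reflect (forall a b, a \in A -> b \in B -> ~~ e a b) (sep e A B).
Proof. exact: allrelP. Qed.

Lemma sepC (W : eqType) (e : rel W) (A B : seq W) :
  symmetric e -> sep e A B = sep e B A.
Proof.
by move=> esym; rewrite /sep allrelC; apply: eq_allrel => a b; rewrite esym.
Qed.

Lemma root_in_rtree (W : eqType) (e : rel W) (x : W) (A : seq W) :
  rtree e x A -> x \in A.
Proof.
by elim=> {x A} [x|x A z B _ xA *]; rewrite ?mem_head // mem_cat xA.
Qed.

Lemma rtree_uniq (W : eqType) (e : rel W) (x : W) (A : seq W) :
  rtree e x A -> uniq A.
Proof. by case. Qed.

(** The vertex [y] is the root or has a branch of more than [m] vertices, while its child branches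
    [Ps] have at most [m]; [R] is what remains above [y]. *)
Lemma cut_rtree (W : eqType) (e : rel W) (m : nat) (x : W) (A : seq W) :
  symmetric e -> rtree e x A ->
  exists y R Ps,
    [/\ perm_eq A (y :: R ++ flatten Ps), pairwise (sep e) (R :: Ps),
        forall P, P \in Ps -> subtree e P /\ size P <= m &
        (y = x /\ R = [::]) \/ (rtree e x R /\ size R + m < size A)].
Proof.
move=> esym; elim=> {x A} [x|x A z B tA IHA tB IHB exz uAB eAB].
  by exists x, [::], [::]; split=> //; left.
move: (uAB); rewrite cat_uniq => /and3P[uA /hasPn/= dAB uB].
(* Edges from [A] to [B] start at [x] only. *)
have subA : forall Y : seq W, {subset Y <= A} -> x \notin Y -> sep e Y B.
  move=> Y YA xY; apply/sepP=> a b aY bB; apply/negP=> eab.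
  by have [ax _] := eAB a b (YA a aY) bB eab; rewrite -ax aY in xY.
(* When [A] is cut below its root, the remainder keeps [x], so [B] still hangs on it. *)
case: IHA => y [R [Ps [pA sPs smallPs]]] [[yx R0]|[tR sR]]; last first.
  have xR := root_in_rtree tR.
  exists y, (R ++ B), Ps; split=> //.
  - by apply/permP=> a; move/permP/(_ a): pA; rewrite /= !count_cat /=; clear; lia.
  - move: sPs; rewrite !pairwise_cons => /andP[/allP sR' ->]; rewrite andbT.
    apply/allP=> P PPs; rewrite /sep allrel_catl [allrel _ R P]sR' //=.
    rewrite -/(sep e B P) sepC //; apply: subA.
      move=> a aP; rewrite (perm_mem pA) inE mem_cat.
      by apply/orP; right; apply/orP; right; apply/flattenP; exists P.
    apply/negP=> xP; move: uA; rewrite (perm_uniq pA) /= cat_uniq.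
    case/and4P=> _ _ /hasPn/(_ x) + _; rewrite /= xR => H.
    by suff: ~~ true by []; apply: H; apply/flattenP; exists P.
  - right; split; last by rewrite !size_cat addnAC ltn_add2r.
    have RA : {subset R <= A}.
      by move=> a aR; rewrite (perm_mem pA) inE mem_cat aR orbT.
    apply: rtree_join tR tB exz _ _ => [|a b /RA aA]; last exact: eAB.
    move: uA; rewrite (perm_uniq pA) /= cat_uniq => /and3P[_ uR _].
    rewrite cat_uniq uR uB andbT /=; apply/hasPn=> b bB /=.
    by apply/negP=> /RA bA; move: (dAB b bB); rewrite bA.
subst y R; rewrite /= in pA sPs.
(* Now [A] is cut at [x]. Either [B] is one more small piece, or the cut moves into [B] and the
   remainder swallows [A]. *)
have [Bm|Bm] := leqP (size B) m.
  exists x, [::], (B :: Ps); split=> //; last by left.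
  - by apply/permP=> a; move/permP/(_ a): pA; rewrite /= !count_cat /=; clear; lia.
  - rewrite !pairwise_cons; apply/and3P; split.
    + by apply/allP=> P _; apply/sepP.
    + apply/allP=> P PPs; rewrite sepC //; apply: subA.
        move=> a aP; rewrite (perm_mem pA) inE.
        by apply/orP; right; apply/flattenP; exists P.
      apply/negP=> xP; move: uA; rewrite (perm_uniq pA) /= => /andP[/negP[]].
      by apply/flattenP; exists P.
    + by case/andP: sPs.
  - move=> P; rewrite inE => /orP[/eqP->|]; last exact: smallPs.
    by split=> //; right; exists z.
case: IHB => y [R [Qs [pB sQs smallQs]]] [[yz R0]|[tR sR]].
  subst y R; rewrite /= in pB sQs.
  exists z, A, Qs; split=> //.
  - by apply/permP=> a; move/permP/(_ a): pB; rewrite /= !count_cat /=; clear; lia.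
  - rewrite /=; case/andP: sQs => _ ->; rewrite andbT.
    apply/allP=> P PQs; apply/sepP=> a b aA bP; apply/negP=> eab.
    have bB : b \in B.
      by rewrite (perm_mem pB) inE; apply/orP; right; apply/flattenP; exists P.
    have [_ bz] := eAB a b aA bB eab.
    move: uB; rewrite (perm_uniq pB) /= -bz => /andP[/negP[]].
    by apply/flattenP; exists P.
  - by right; split=> //; rewrite size_cat ltn_add2l.
have zR := root_in_rtree tR.
exists y, (A ++ R), Qs; split=> //.
- by apply/permP=> a; move/permP/(_ a): pB; rewrite /= !count_cat /=; clear; lia.
- move: sQs; rewrite !pairwise_cons => /andP[/allP sR' ->]; rewrite andbT.
  apply/allP=> P PQs; rewrite /sep allrel_catl [allrel _ R P]sR' // andbT.
  apply/allrelP=> a b aA bP; apply/negP=> eab.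
  have bB : b \in B.
    rewrite (perm_mem pB) inE mem_cat; apply/orP; right; apply/orP; right.
    by apply/flattenP; exists P.
  have [_ bz] := eAB a b aA bB eab.
  move: uB; rewrite (perm_uniq pB) /= cat_uniq => /and4P[_ _ /hasPn/(_ b) + _].
  rewrite /= bz zR => H; suff: ~~ true by [].
  by apply: H; apply/flattenP; exists P; rewrite // -bz.
- right; split; last by rewrite !size_cat -addnA ltn_add2l.
  have RB : {subset R <= B}.
    by move=> a aR; rewrite (perm_mem pB) inE mem_cat aR orbT.
  apply: rtree_join tA tR exz _ _ => [|a b aA /RB bB]; last exact: eAB.
  move: uB; rewrite (perm_uniq pB) /= cat_uniq => /and3P[_ uR _].
  rewrite cat_uniq uA uR andbT /=; apply/hasPn=> b /RB bB /=.
  exact: (dAB b bB).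
Qed.

Lemma cut_subtree (W : eqType) (e : rel W) (m : nat) (A : seq W) :
  symmetric e -> subtree e A -> m < size A ->
  exists y R Ps,
    [/\ perm_eq A (y :: R ++ flatten Ps), pairwise (sep e) (R :: Ps),
        forall P, P \in R :: Ps -> subtree e P,
        forall P, P \in Ps -> size P <= m & size R + m < size A].
Proof.
move=> esym [->//|[x tA]] mA.
have [y [R [Ps [pA sPs smallPs eR]]]] := cut_rtree m esym tA.
exists y, R, Ps; split=> //.
- move=> P; rewrite inE => /orP[/eqP->|/smallPs[]//].
  by case: eR => [[_ ->]|[tR _]]; [left|right; exists x].
- by move=> P /smallPs[].
- by case: eR => [[_ ->]|[]].
Qed.

(** * Finite trees as rooted trees *)

Lemma rtree_connect (W : finType) (e : rel W) (x : W) (A : seq W) :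
  symmetric e -> rtree e x A ->
  forall a, a \in A -> connect [rel u v | [&& e u v, u \in A & v \in A]] x a.
Proof.
move=> esym; elim=> {x A} [x|x A z B tA IHA tB IHB exz uAB eAB] a.
  by rewrite inE => /eqP->.
have up (Y : seq W) : {subset Y <= A ++ B} ->
    subrel (connect [rel u v | [&& e u v, u \in Y & v \in Y]])
           (connect [rel u v | [&& e u v, u \in A ++ B & v \in A ++ B]]).
  move=> YAB; apply: connect_sub => u v /= /and3P[euv uY vY].
  by apply: connect1; rewrite /= euv !YAB.
have sA : {subset A <= A ++ B} by move=> b bA; rewrite mem_cat bA.
have sB : {subset B <= A ++ B} by move=> b bB; rewrite mem_cat bB orbT.
rewrite mem_cat => /orP[aA|aB]; first exact: up sA _ _ (IHA a aA).
apply: (connect_trans _ (up _ sB _ _ (IHB a aB))).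
by apply: connect1; rewrite /= exz (sA _ (root_in_rtree tA)) (sB _ (root_in_rtree tB)).
Qed.

(** The leaf enters the half of each join that contains [y], so it may land in mid-list; hence the
    permutation. *)
Lemma rtree_add_leaf (W : eqType) (e : rel W) (x y z : W) (A : seq W) :
  symmetric e -> rtree e x A -> y \in A -> z \notin A -> e y z ->
  (forall a, a \in A -> e a z -> a = y) ->
  exists2 B, rtree e x B & perm_eq B (z :: A).
Proof.
move=> esym; elim=> {x A} [x|x A r B tA IHA tB IHB exr uAB eAB].
  rewrite !inE => /eqP-> zx exz _; exists [:: x; z].
    apply: (@rtree_join _ e x [:: x] z [:: z]) => //; try exact: rtree1.
      by rewrite /= inE eq_sym zx.
    by move=> a b; rewrite !inE => /eqP-> /eqP->.
  by apply/permP=> a /=; lia.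
move: (uAB); rewrite cat_uniq => /and3P[uA /hasPn/= dAB uB].
rewrite !mem_cat negb_or => yAB /andP[zA zB] eyz zy.
have {yAB}[yA|yB] := orP yAB.
  have yB : y \notin B by apply/negP=> /dAB; rewrite yA.
  have [//|//|//|a aA|C tC pC] := IHA; first by apply: zy; rewrite mem_cat aA.
  exists (C ++ B); last by rewrite -cat_cons perm_cat2r.
  apply: rtree_join tC tB exr _ _.
    by rewrite (perm_uniq (_ : perm_eq _ (z :: A ++ B))) ?perm_cat2r //=
      ?mem_cat ?negb_or ?zA ?zB // -cat_cons perm_cat2r.
  move=> a b; rewrite (perm_mem pC) inE => /orP[/eqP->|]; last exact: eAB.
  move=> bB ezb; have := zy b; rewrite mem_cat bB orbT esym ezb.
  by move=> /(_ isT isT) yb; rewrite -yb bB in yB.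
have yA : y \notin A by exact: dAB.
have [//|//|//|a aB|C tC pC] := IHB; first by apply: zy; rewrite mem_cat aB orbT.
have pAC : perm_eq (A ++ C) (z :: A ++ B).
  by apply/permP=> a; move/permP/(_ a): pC; rewrite /= !count_cat /=; clear; lia.
exists (A ++ C) => //.
apply: rtree_join tA tC exr _ _.
  by rewrite (perm_uniq pAC) /= mem_cat negb_or zA zB.
move=> a b aA; rewrite (perm_mem pC) inE => /orP[/eqP->|]; last exact: eAB.
by move=> eaz; have := zy a; rewrite mem_cat aA eaz => /(_ isT isT) ay;
  rewrite -ay aA in yA.
Qed.

(** The list grows leaf by leaf from [r]: connectedness gives an edge leaving it, and acyclicity
    makes the new vertex a leaf. *)
Lemma tree_rtree (W : finType) (T : sgraph W) :
  is_tree T -> exists2 A, subtree (adj T) A & perm_eq A (enum W).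
Proof.
move=> [[/card_gt0P[r _] cT] aT].
have esym := adj_sym T.
suff grow k : k < #|W| -> exists2 A, rtree (adj T) r A & size A = k.+1.
  have W0 : 0 < #|W| by apply/card_gt0P; exists r.
  have [|A tA sA] := grow #|W|.-1; first by rewrite prednK.
  exists A; first by right; exists r.
  apply: uniq_perm; rewrite ?enum_uniq ?(rtree_uniq tA) //.
  have AW : {subset A <= enum W} by move=> a _; rewrite mem_enum.
  apply: (uniq_min_size (rtree_uniq tA) AW _).2.
  by rewrite sA -cardE prednK.
elim: k => [_|k IH kW]; first by exists [:: r] => //; exact: rtree1.
have [A tA sA] := IH (ltnW kW).
have rA := root_in_rtree tA.
have [w wA] : exists w, w \notin A.
  apply/existsP; rewrite -negb_forall; apply/negP=> /forallP AW.
  have: #|W| <= size A.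
    by apply: leq_trans (card_size A); apply/subset_leq_card/subsetP=> a _; rewrite AW.
  by rewrite sA leqNgt kW.
have [y [z [yA zA eyz]]] : exists y z, [/\ y \in A, z \notin A & adj T y z].
  have /connectP[p] := cT r w.
  elim: p r rA {tA IH} => [|v p IHp] u uA /=; first by move=> _ wu; rewrite wu uA in wA.
  case/andP=> euv pp ww; case vA: (v \in A); first exact: IHp vA pp ww.
  by exists u, v; rewrite vA.
have [] := rtree_add_leaf esym tA yA zA eyz _; last first.
  by move=> B tB pB; exists B => //; rewrite (perm_size pB) /= sA.
move=> a aA eaz; apply/eqP/negPn/negP=> ay.
have inA_sym : connect_sym [rel u v | [&& adj T u v, u \in A & v \in A]].
  apply: sym_connect_sym => u v /=.
  by rewrite esym [(u \in A) && _]andbC.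
have rconn := rtree_connect esym tA.
have conn : connect [rel u v | [&& adj T u v, u \in A & v \in A]] a y.
  by apply: (connect_trans _ (rconn y yA)); rewrite inA_sym; exact: rconn.
have /connectP[p0 pp0 lp0] := conn.
case: (shortenP pp0) lp0 => p pp up _ yp.
have pT : path (adj T) a p by apply: sub_path pp => u v /= /and3P[].
have pA : {subset p <= A}.
  elim: p a {aA eaz ay conn p0 pp0 up yp pT} pp => [|v p IHp] u //=.
  case/andP=> /and3P[_ _ vA] pp w'; rewrite inE => /orP[/eqP->//|].
  exact: IHp pp w'.
have zp : z \notin a :: p.
  rewrite inE negb_or; apply/andP; split; first by apply: contraNneq zA => ->.
  by apply: contra zA => /pA.
(* The path from [a] to [y] inside [A] closes up through [z]. As [a] differs from [y], [p] is
   nonempty and the cycle has at least three vertices. *)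
suff : size (z :: a :: p) < 3.
  by case: p yp {pp up pT pA zp} => //= ya; rewrite ya eqxx in ay.
apply: aT; apply/andP; split; last by rewrite cons_uniq zp.
by rewrite /= rcons_path -yp eyz pT esym eaz.
Qed.

(** * Host adjacency and placements *)

(* For [p = (2k+1) * 2^i] this is [3 * 2^i] when [k] is even, [2 * 2^i] when [k]
   is odd; [p = 0] gets the junk value [3]. *)
Definition weight (p : nat) : nat :=
  (if odd (p %/ 2 ^ logn 2 p)./2 then 2 else 3) * 2 ^ logn 2 p.

(** The slack [3] pays for occupied multiples of the scale inside an interval; see [span_bound]. *)
Definition reach (p : nat) : nat := weight p + 3.

Definition near : rel nat := fun p q =>
  (p != q) && [|| (p <= q + reach p) && (q <= p + reach p)
                | (p <= q + reach q) && (q <= p + reach q)].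

(* The tree on [A] embeds into the free positions [c]; in all uses
   [size c = size A]. *)
Definition place (W : eqType) (e : rel W) (c : seq nat) (A : seq W) : Prop :=
  exists f : W -> nat,
    [/\ {in A, forall x, f x \in c}, {in A &, injective f}
      & {in A &, forall x y, e x y -> near (f x) (f y)}].

(** Multiples of [u] are the positions that coarser scales may have used up. *)
Definition dense (u : nat) (c : seq nat) : Prop :=
  forall a b p, a \in c -> b \in c -> a <= p <= b -> ~~ (u %| p) -> p \in c.

Lemma near_sym : symmetric near.
Proof.
move=> p q; rewrite /near eq_sym orbC; congr (_ && (_ || _)); exact: andbC.
Qed.

Lemma near_irr : irreflexive near.
Proof. by move=> p; rewrite /near eqxx. Qed.

Lemma weight_odd (k i : nat) :
  weight (k.*2.+1 * 2 ^ i) = (if odd k then 2 else 3) * 2 ^ i.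
Proof.
have lE : logn 2 (k.*2.+1 * 2 ^ i) = i.
  rewrite lognM ?expn_gt0 // pfactorK // logn_coprime //.
  by rewrite coprime2n /= odd_double.
by rewrite /weight lE mulnK ?expn_gt0 //= uphalf_double.
Qed.

Lemma near_odd (k i p : nat) (q := k.*2.+1 * 2 ^ i)
    (r := (if odd k then 2 else 3) * 2 ^ i + 3) :
  p != q -> p <= q + r -> q <= p + r -> near q p.
Proof. by move=> pq pqr qpr; rewrite /near eq_sym pq /reach weight_odd pqr qpr. Qed.

Lemma place_sub (W : eqType) (e : rel W) (c d : seq nat) (A B : seq W) :
  {subset c <= d} -> {subset B <= A} -> place e c A -> place e d B.
Proof.
move=> cd BA [f [fc fI fe]]; exists f; split.
- by move=> x /BA/fc/cd.
- by move=> x y /BA xA /BA; apply: fI.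
- by move=> x y /BA xA /BA; apply: fe.
Qed.

Lemma place_cat (W : eqType) (e : rel W) (c d : seq nat) (A B : seq W) :
  symmetric e -> (forall p, p \in c -> p \notin d) -> sep e A B ->
  place e c A -> place e d B -> place e (c ++ d) (A ++ B).
Proof.
move=> esym cd /sepP sAB [f [fc fI fe]] [g [gd gI ge]].
exists (fun x => if x \in A then f x else g x); split.
- move=> x; rewrite !mem_cat; case: ifP => [/fc->//|_ /= /gd->].
  by rewrite orbT.
- move=> x y; rewrite !mem_cat.
  case: ifP => xA; case: ifP => yA /= xB yB; first exact: fI.
  + by move=> fg; have := cd _ (fc _ xA); rewrite fg gd.
  + by move=> gf; have := cd _ (fc _ yA); rewrite -gf gd.
  + exact: gI.
- move=> x y; rewrite !mem_cat.
  case: ifP => xA; case: ifP => yA /= xB yB; first exact: fe.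
  + by rewrite (negbTE (sAB _ _ xA yB)).
  + by rewrite esym (negbTE (sAB _ _ yA xB)).
  + exact: ge.
Qed.

Lemma place_cons (W : eqType) (e : rel W) (q : nat) (c : seq nat) (y : W)
    (A : seq W) :
  symmetric e -> irreflexive e -> (forall p, p \in c -> near q p) ->
  place e c A -> place e (q :: c) (y :: A).
Proof.
move=> esym eirr qc [f [fc fI fe]].
have qNc : q \notin c by apply/negP=> /qc; rewrite near_irr.
exists (fun x => if x == y then q else f x); split.
- by move=> x; rewrite !inE; case: ifP => [|_ /= /fc->]; rewrite ?eqxx ?orbT.
- move=> x z; rewrite !inE.
  case: eqP => [->|_] /=; case: eqP => [->|_] //= xA zA.
  + by move=> qf; rewrite qf fc in qNc.
  + by move=> fq; rewrite -fq fc in qNc.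
  + exact: fI.
- move=> x z; rewrite !inE.
  case: eqP => [->|_] /=; case: eqP => [->|_] //= xA zA.
  + by rewrite eirr.
  + by move=> _; apply/qc/fc.
  + by move=> _; rewrite near_sym; apply/qc/fc.
  + exact: fe.
Qed.

(** * Dense position lists and packing into chunks *)

Lemma dense_dvd (h u : nat) (c : seq nat) : h %| u -> dense u c -> dense h c.
Proof.
move=> hu cu a b p ac bc apb hp; apply: cu ac bc apb _.
by apply: contra hp; exact: dvdn_trans.
Qed.

Lemma dense_filter (u q : nat) (c : seq nat) :
  u %| q -> dense u c -> dense u [seq p <- c | p != q].
Proof.
move=> uq cu a b p; rewrite !mem_filter => /andP[_ ac] /andP[_ bc] apb up.
by rewrite (cu a b) // andbT; apply: contraNneq up => ->.
Qed.

Lemma size_filter_neq (q : nat) (c : seq nat) :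
  uniq c -> q \in c -> size [seq p <- c | p != q] = (size c).-1.
Proof. by move=> uc qc; rewrite -(size_rem qc) rem_filter. Qed.

Lemma sorted_take_drop (k : nat) (c : seq nat) :
  sorted ltn c ->
  forall p q, p \in take k c -> q \in drop k c -> p < q.
Proof.
move=> sc p q pt qd; move: sc; rewrite -{1}(cat_take_drop k c).
rewrite sorted_pairwise; last exact: ltn_trans.
by rewrite pairwise_cat => /and3P[/allrelP/(_ p q pt qd)].
Qed.

Lemma dense_take (u k : nat) (c : seq nat) :
  sorted ltn c -> dense u c -> dense u (take k c).
Proof.
move=> sc cu a b p at' bt apb up.
have : p \in c by apply: (cu a b) => //; apply: mem_take; eassumption.
rewrite -{1}(cat_take_drop k c) mem_cat => /orP[//|pd].
by have := sorted_take_drop sc bt pd; case/andP: apb => _; rewrite leqNgt => /negbTE->.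
Qed.

Lemma dense_drop (u k : nat) (c : seq nat) :
  sorted ltn c -> dense u c -> dense u (drop k c).
Proof.
move=> sc cu a b p ad bd apb up.
have : p \in c by apply: (cu a b) => //; apply: mem_drop; eassumption.
rewrite -{1}(cat_take_drop k c) mem_cat => /orP[pt|//].
by have := sorted_take_drop sc pt ad; case/andP: apb; rewrite leqNgt => /negbTE->.
Qed.

(** Each part takes the next chunk of [c]: chunks of a sorted dense list stay sorted and dense, and
    no edge joins two parts. *)
Lemma place_parts (W : eqType) (e : rel W) (u : nat) (Ps : seq (seq W)) :
  symmetric e -> pairwise (sep e) Ps ->
  (forall P d, P \in Ps -> sorted ltn d -> dense u d -> size d = size P ->
     place e d P) ->
  forall c, sorted ltn c -> dense u c -> size c = size (flatten Ps) ->
  place e c (flatten Ps).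
Proof.
move=> esym; elim: Ps => [|P Ps IH] /=.
  by move=> _ _ c _ _ /size0nil->; exists (fun=> 0); split=> x.
move=> /andP[/allP sP sPs] plP c sc cu; rewrite size_cat => sz.
rewrite -(cat_take_drop (size P) c); apply: place_cat => //.
- move=> p pt; apply/negP=> pd.
  by have := sorted_take_drop sc pt pd; rewrite ltnn.
- apply/sepP=> a b aP /flattenP[Q QPs bQ].
  by move/sepP: (sP Q QPs); apply.
- apply: plP; rewrite ?mem_head ?take_sorted //; first exact: dense_take.
  by rewrite size_takel // sz leq_addr.
- apply: IH; rewrite ?drop_sorted //.
  + by move=> Q d QPs; apply: plP; rewrite inE QPs orbT.
  + exact: dense_drop.
  + by rewrite size_drop sz addKn.
Qed.

Lemma place_vertex (W : eqType) (e : rel W) (q : nat) (c : seq nat) (y : W)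
    (A B : seq W) :
  symmetric e -> irreflexive e -> q \in c ->
  (forall p, p \in c -> p != q -> near q p) -> perm_eq A (y :: B) ->
  place e [seq p <- c | p != q] B -> place e c A.
Proof.
move=> esym eirr qc qnear pA plB.
apply: (@place_sub _ e (q :: [seq p <- c | p != q]) _ (y :: B)).
- by move=> p; rewrite inE mem_filter => /orP[/eqP->//|/andP[]].
- by move=> a; rewrite (perm_mem pA).
- by apply: place_cons => // p; rewrite mem_filter => /andP[pq pc]; exact: qnear.
Qed.

(** Cutting with [m] half the size bounds the remainder by half the size as well, so [IH] applies to
    all parts. *)
Lemma place_centroid (W : eqType) (e : rel W) (h q : nat) (c : seq nat)
    (A : seq W) :
  symmetric e -> irreflexive e ->
  (forall d P, sorted ltn d -> dense h d -> subtree e P -> size d = size P ->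
     2 * size P <= size A -> place e d P) ->
  sorted ltn c -> dense h c -> subtree e A -> size c = size A ->
  h %| q -> q \in c -> (forall p, p \in c -> p != q -> near q p) ->
  place e c A.
Proof.
move=> esym eirr IH sc ch tA sz hq qc qnear.
have A0 : 0 < size A by rewrite -sz; case: (c) qc.
have [|y [R [Ps [pA sPs tPs smallPs smallR]]]] :=
  cut_subtree (m := (size A)./2) esym tA; first by lia.
apply: (place_vertex esym eirr qc qnear pA).
apply: (@place_parts _ e h (R :: Ps)) => //.
- move=> P d PRs sd dh szd; apply: IH => //; first exact: tPs.
  by move: PRs; rewrite inE => /orP[/eqP->|/smallPs]; lia.
- by rewrite sorted_filter //; exact: ltn_trans.
- exact: dense_filter.
- rewrite size_filter_neq ?sz ?(perm_size pA) //.
  exact: sorted_uniq ltn_trans ltnn _ sc.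
Qed.

Lemma size_range (a m : nat) (c : seq nat) :
  uniq c -> (forall p, p \in c -> a <= p < a + m) -> size c <= m.
Proof.
move=> uc cam; rewrite -(size_iota a m); apply: uniq_leq_size => // p pc.
by rewrite mem_iota cam.
Qed.

(** Among [size c + 4] consecutive positions from [a] at most four are multiples of [2h]. If [b] lay
    beyond them, the others together with [b] would outnumber [c]. *)
Lemma span_bound (h a b : nat) (c : seq nat) :
  0 < h -> uniq c -> dense h.*2 c -> size c <= 3 * h ->
  a \in c -> b \in c -> b <= a + (3 * h + 3).
Proof.
move=> h0 uc cu cs ac bc; rewrite leqNgt; apply/negP=> abig.
set u := h.*2; set w := iota a (size c + 4).
have u0 : 0 < u by rewrite /u; lia.
have szw : count (dvdn u) w + count (predC (dvdn u)) w = size c + 4.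
  by rewrite count_predC size_iota.
(* Two positions of the window differ by at most [3h + 3 <= 3u], so quotients by [u] take at most
   four values. *)
have multiples : count (dvdn u) w <= 4.
  rewrite -size_filter -(size_map (divn^~ u)).
  apply: (size_range (a := a %/ u)).
    rewrite map_inj_in_uniq ?filter_uniq ?iota_uniq // => p q.
    rewrite !mem_filter => /andP[up _] /andP[uq _] pq.
    by rewrite -(divnK up) -(divnK uq) pq.
  move=> _ /mapP[p + ->]; rewrite mem_filter mem_iota => /and3P[_ ap pw].
  have le3 : p %/ u <= (3 * u + a) %/ u by apply: leq_div2r; rewrite /u; lia.
  rewrite divnMDl // in le3.
  by rewrite leq_div2r //= addn4 ltnS -addn3 addnC.
have : size (b :: filter (predC (dvdn u)) w) <= size c.
  apply: uniq_leq_size.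
    rewrite /= mem_filter mem_iota filter_uniq ?iota_uniq //.
    by rewrite andbT; apply/negP=> /and3P[_ _]; lia.
  move=> p; rewrite inE mem_filter mem_iota => /orP[/eqP->//|/and3P[/= up ap pw]].
  by apply: (cu a b) => //; rewrite ap; lia.
by rewrite /= size_filter; lia.
Qed.

(** * Placement, one scale at a time *)

(** The second case is the open interval from [(k-1)h] to [(k+1)h], stated without truncated
    subtraction. *)
Definition fits (h : nat) (c : seq nat) : Prop :=
  2 * size c <= 3 * h \/
  exists k, forall p, p \in c -> k * h < p + h /\ p < k.+1 * h.

(* [c] lies in a window of width [4h] starting at [b], and [w] is the midpoint of
   its left or right half; the chunk is taken at that end. *)
Lemma end_chunk (h b r w : nat) (c : seq nat) :
  sorted ltn c -> dense h c -> (forall p, p \in c -> b < p < b + 4 * h) ->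
  w \in c -> w = b + h \/ w = b + 3 * h -> 3 * h < 2 * r ->
  2 * r + 3 * h <= 2 * size c + 1 ->
  exists d d' : seq nat,
    [/\ [/\ sorted ltn d, dense h d & size d = r],
        [/\ sorted ltn d', dense h d' & size d' = size c - r],
        (forall p, p \in d -> p \notin d') /\ {subset d ++ d' <= c},
        w \in d & forall p, p \in d -> p <= w + 2 * h /\ w <= p + 2 * h].
Proof.
move=> sc ch cb wc wb r1 r2.
have uc : uniq c by exact: sorted_uniq ltn_trans ltnn _ sc.
have utd k : uniq (take k c) /\ uniq (drop k c).
  by rewrite take_uniq ?drop_uniq.
have td k : {subset take k c ++ drop k c <= c} by rewrite cat_take_drop.
have ltd k := @sorted_take_drop k c sc.
have in_td k p : p \in c -> (p \in take k c) || (p \in drop k c).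
  by rewrite -{1}(cat_take_drop k c) mem_cat.
have tc k p : p \in take k c -> p \in c by exact: mem_take.
have dc k p : p \in drop k c -> p \in c by exact: mem_drop.
case: wb => wb.
- exists (take r c), (drop r c).
  have szt : size (take r c) = r by rewrite size_takel //; lia.
  have szd := size_drop r c.
  (* Otherwise the chunk lies left of [w], where there is room for fewer than [r] positions. *)
  have wt : w \in take r c.
    have /orP[//|wd] := in_td r w wc.
    have := @size_range b.+1 h (take r c) (utd r).1.
    have h0 : forall p, p \in take r c -> b < p < b.+1 + h.
      by move=> p pt; have := ltd r _ _ pt wd; have := cb p (tc r p pt); lia.
    by move=> /(_ h0); lia.
  split=> //.
  + by split=> //; [exact: take_sorted|exact: dense_take].
  + by split=> //; [exact: drop_sorted|exact: dense_drop].
  + split=> // p pt; apply/negP=> pd.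
    by have := ltd r _ _ pt pd; rewrite ltnn.
  (* The positions outside the chunk number at least [(3h - 1)/2], hence at least [h], and lie
     between [p] and [b + 4h]; this keeps [p] within [2h] of [w]. *)
  + move=> p pt; have pb := cb p (tc r p pt); split; last by lia.
    have := @size_range p.+1 (b + 4 * h - p.+1) (drop r c) (utd r).2.
    have h0 : forall q, q \in drop r c -> p < q < p.+1 + (b + 4 * h - p.+1).
      by move=> q qd; have := ltd r _ _ pt qd; have := cb q (dc r q qd); lia.
    by move=> /(_ h0); lia.
- set k := size c - r; exists (drop k c), (take k c).
  have szt : size (take k c) = k by rewrite size_takel // /k; lia.
  have szd := size_drop k c.
  have wd : w \in drop k c.
    have /orP[wt|//] := in_td k w wc.
    have := @size_range w h (drop k c) (utd k).2.
    have h0 : forall p, p \in drop k c -> w <= p < w + h.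
      by move=> p pd; have := ltd k _ _ wt pd; have := cb p (dc k p pd); lia.
    by move=> /(_ h0); lia.
  split=> //.
  + by split; [exact: drop_sorted|exact: dense_drop|lia].
  + by split=> //; [exact: take_sorted|exact: dense_take].
  + split=> [p pd|p]; last by rewrite mem_cat orbC -mem_cat; exact: td.
    by apply/negP=> pt; have := ltd k _ _ pt pd; rewrite ltnn.
  + move=> p pd; have pb := cb p (dc k p pd); split; first by lia.
    have := @size_range b.+1 (p - b.+1) (take k c) (utd k).1.
    have h0 : forall q, q \in take k c -> b < q < b.+1 + (p - b.+1).
      by move=> q qt; have := ltd k _ _ qt pd; have := cb q (tc k q qt); lia.
    by move=> /(_ h0); lia.
Qed.

Lemma place_wide (W : eqType) (e : rel W) (i k : nat) (h := 2 ^ i)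
    (c : seq nat) (A : seq W) :
  symmetric e -> irreflexive e ->
  (forall d P, sorted ltn d -> dense h d -> subtree e P -> size d = size P ->
     2 * size P <= 3 * h -> place e d P) ->
  sorted ltn c -> dense h.*2 c -> subtree e A -> size c = size A ->
  3 * h < size A ->
  (forall p, p \in c -> k * h.*2 < p + h.*2 /\ p < k.+1 * h.*2) ->
  place e c A.
Proof.
move=> esym eirr IH sc cu tA sz big; have h0 : 0 < h by rewrite expn_gt0.
have uc : uniq c by exact: sorted_uniq ltn_trans ltnn _ sc.
(* For [k = 0] the list lies below [2h], too short for [big]. *)
case: k => [|k] ck.
  have := @size_range 0 h.*2 c uc; suff ch : forall p, p \in c -> 0 <= p < 0 + h.*2.
    by move=> /(_ ch); lia.
  by move=> p /ck; lia.
set b := k * h.*2.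
have cb p : p \in c -> b < p < b + 4 * h by move=> /ck; rewrite /b !mulSn; lia.
have Nbound : size A <= 4 * h.
  by rewrite -sz; apply: (size_range (a := b)) => // p /cb; case/andP=> /ltnW->.
have q1E : k.*2.+1 * 2 ^ i = b + h by rewrite /b /h; nia.
have q2E : k.+1.*2.+1 * 2 ^ i = b + 3 * h by rewrite /b /h; nia.
(* The window has fewer than [3h] positions on either side of [q], so [c] has elements on both sides
   and density yields [q]. *)
have oddc q : q = b + h \/ q = b + 3 * h -> q \in c.
  move=> qb; have hq : ~~ (h.*2 %| q).
    by rewrite -mul2n; case: qb => ->; rewrite -?q1E -?q2E dvdn_pmul2r // dvdn2
       /= odd_double.
  have [a ac aq] : exists2 a, a \in c & a <= q.
    apply/hasP; rewrite -[has _ _]negbK -all_predC; apply/negP=> /allP/= H.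
    have := @size_range q.+1 (3 * h) c uc.
    have H' : forall p, p \in c -> q < p < q.+1 + 3 * h.
      by move=> p pc; have := H p pc; have := cb p pc; lia.
    by move=> /(_ H'); lia.
  have [a' ac' aq'] : exists2 a, a \in c & q <= a.
    apply/hasP; rewrite -[has _ _]negbK -all_predC; apply/negP=> /allP/= H.
    have := @size_range b.+1 (3 * h) c uc.
    have H' : forall p, p \in c -> b < p < b.+1 + 3 * h.
      by move=> p pc; have := H p pc; have := cb p pc; lia.
    by move=> /(_ H'); lia.
  by apply: (cu a a') => //; rewrite aq aq'.
have ch : dense h c by apply: dense_dvd cu; rewrite -mul2n dvdn_mull.
have near_at j q : q = j.*2.+1 * 2 ^ i -> forall p, p != q ->
    p <= q + (if odd j then 2 else 3) * h ->
    q <= p + (if odd j then 2 else 3) * h -> near q p.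
  move=> -> p pq p1 p2; apply: near_odd => //; rewrite addnA.
    by apply: leq_trans p1 (leq_addr _ _).
  by apply: leq_trans p2 (leq_addr _ _).
have near1 := near_at k _ (Logic.eq_sym q1E).
have near2 := near_at k.+1 _ (Logic.eq_sym q2E).
(* Since [k] and [k.+1] differ in parity, one of the two odd multiples is strong ([s]) and the other
   weak ([w]). *)
have [s [w [sb wb snear wnear sw]]] : exists s w,
    [/\ s = b + h \/ s = b + 3 * h, w = b + h \/ w = b + 3 * h,
        forall p, p != s -> p <= s + 3 * h -> s <= p + 3 * h -> near s p,
        forall p, p != w -> p <= w + 2 * h -> w <= p + 2 * h -> near w p
      & s != w].
  move: near1 near2; rewrite /=; case: (odd k) => /= near1 near2.
    by exists (b + 3 * h), (b + h); split; auto; lia.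
  by exists (b + h), (b + 3 * h); split; auto; lia.
(* Pieces of at most [3h/2] vertices suit [IH] directly; the remainder has at most [3h], so halving
   it once suffices. *)
have [|y [R [Ps [pA sPs tPs smallPs smallR]]]] :=
  cut_subtree (m := (3 * h)./2) esym tA; first by lia.
have Rsmall : size R <= 3 * h by clear - Nbound smallR h0; lia.
apply: (place_vertex (q := s) (B := R ++ flatten Ps) esym eirr _ _ pA).
- exact: oddc.
- by move=> p pc ps; apply: snear => //; have := cb p pc; lia.
set c' := [seq p <- c | p != s].
have sc' : sorted ltn c' by rewrite sorted_filter //; exact: ltn_trans.
have hs : h %| s.
  by case: sb => ->; rewrite -?q1E -?q2E dvdn_mull.
have hw : h %| w.
  by case: wb => ->; rewrite -?q1E -?q2E dvdn_mull.
have ch' : dense h c' by exact: dense_filter.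
have szc' : size c' = size (R ++ flatten Ps).
  by rewrite size_filter_neq ?oddc // sz (perm_size pA).
have plPs P d : P \in Ps -> sorted ltn d -> dense h d -> size d = size P ->
    place e d P.
  move=> PPs sd dh szd; apply: IH => //; last first.
    by move: (smallPs P PPs); clear; lia.
  by apply: tPs; rewrite inE PPs orbT.
have [Rh|Rh] := leqP (2 * size R) (3 * h).
  apply: (@place_parts _ e h (R :: Ps)) => // P d.
  rewrite inE => /orP[/eqP->|]; last exact: plPs.
  by move=> sd dh szd; apply: IH => //; apply: tPs; rewrite mem_head.
have szA := perm_size pA; rewrite /= in szA.
have [|||d [d' [[sd dh szd] [sd' dh' szd'] [dd' dc'] wd dnear]]] :=
    @end_chunk h b (size R) w c' sc' ch' _ _ wb Rh _.
- by move=> p; rewrite mem_filter => /andP[_ /cb].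
- by rewrite mem_filter oddc // eq_sym sw.
(* This is [smallR] with [c'] one shorter than [A]; the [+ 1] covers the rounding in
   [(3 * h)./2]. *)
- by rewrite szc'; lia.
have [sRPs sPs'] : sep e R (flatten Ps) /\ pairwise (sep e) Ps.
  move: sPs; rewrite pairwise_cons => /andP[/allP sR ->]; split=> //.
  apply/sepP=> x z xR /flattenP[P PPs zP].
  by move/sepP: (sR P PPs); apply.
apply: (place_sub (c := d ++ d') (A := R ++ flatten Ps)) => //.
apply: place_cat => //.
- apply: (place_centroid (h := h) (q := w)) => //.
  + move=> f P sf fh tP szf small; apply: IH => //.
    exact: leq_trans small Rsmall.
  + by apply: tPs; rewrite mem_head.
  + by move=> p pd pw; have [] := dnear p pd; exact: wnear.
- apply: (@place_parts _ e h Ps) => //.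
  by rewrite szd' szc' size_cat addKn.
Qed.

Lemma place_narrow (W : eqType) (e : rel W) (i : nat) (h := 2 ^ i)
    (c : seq nat) (A : seq W) :
  symmetric e -> irreflexive e ->
  (forall d P, sorted ltn d -> dense h d -> subtree e P -> size d = size P ->
     fits h d -> place e d P) ->
  sorted ltn c -> dense h.*2 c -> subtree e A -> size c = size A ->
  size A <= 3 * h -> place e c A.
Proof.
move=> esym eirr IH sc cu tA sz small; have h0 : 0 < h by rewrite expn_gt0.
have uc : uniq c by exact: sorted_uniq ltn_trans ltnn _ sc.
have ch : dense h c by apply: dense_dvd cu; rewrite -mul2n dvdn_mull.
have oddN k : ~~ (h.*2 %| k.*2.+1 * h).
  by rewrite -mul2n dvdn_pmul2r // dvdn2 /= odd_double.
have cut k : k.*2.+1 * h \in c ->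
    (forall p, p \in c -> p != k.*2.+1 * h -> near (k.*2.+1 * h) p) ->
    place e c A.
  move=> qc qnear; apply: (place_centroid esym eirr _ sc ch tA sz _ qc qnear).
    by move=> d P sd dh tP szd P2; apply: IH => //; left; lia.
  exact: dvdn_mull.
have between p q k : p \in c -> q \in c -> p <= k.*2.+1 * h <= q ->
    k.*2.+1 * h \in c.
  by move=> pc qc pq; exact: cu pc qc pq (oddN k).
have [[k ok kc]|noStrong] := pselect (exists2 k, ~~ odd k & k.*2.+1 * h \in c).
  apply: (cut k kc) => p pc pk; apply: near_odd => //; rewrite (negbTE ok).
    by apply: (span_bound h0 uc cu _ kc pc); rewrite sz.
  by apply: (span_bound h0 uc cu _ pc kc); rewrite sz.
(* The odd multiples next to a weak one are strong, hence absent from [c]; by density [c] stays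
   within [2h] of the weak one. *)
have [[k kc]|noOdd] := pselect (exists k, k.*2.+1 * h \in c).
  have ok : odd k by apply/negPn/negP=> ok; apply: noStrong; exists k.
  apply: (cut k kc) => p pc pk; apply: near_odd => //; rewrite ok.
    rewrite leqNgt; apply/negP=> pbig; apply: noStrong; exists k.+1 => /=.
      by rewrite ok.
    by apply: between kc pc _; move: pbig; rewrite -/h doubleS; lia.
  rewrite leqNgt; apply/negP=> pbig; apply: noStrong; exists k.-1.
    by case: (k) ok => //= j; rewrite negbK.
  apply: between pc kc _; case: (k) ok pbig => //= j _.
  by rewrite -/h doubleS; lia.
apply: IH => //; case: c => [|a c0] in sc cu sz uc ch cut between noStrong noOdd *.
  by left.
(* No odd multiple of [h] is in [c], so [c] lies between the two consecutive ones around [a]; the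
   quotient picks the multiple of [2h] midway. *)
right; exists ((a + h) %/ h.*2).*2 => p pc.
set m := (a + h) %/ h.*2.
have h20 : 0 < h.*2 by lia.
have alo : m * h.*2 <= a + h by exact: leq_trunc_div.
have ahi : a + h < m.+1 * h.*2 by exact: ltn_ceil.
have ac := mem_head a c0.
split.
  rewrite ltnNge; apply/negP=> pm.
  case E: m => [|j]; first by rewrite E /= in pm; lia.
  apply: noOdd; exists j; apply: between pc ac _.
  by rewrite E in alo pm; nia.
rewrite ltnNge; apply/negP=> pm; apply: noOdd; exists m.
by apply: between ac pc _; rewrite pm andbT; nia.
Qed.

(** Induction on the scale. At scale [1], [fits] leaves at most one position. *)
Lemma place_subtree (W : eqType) (e : rel W) (i : nat) :
  symmetric e -> irreflexive e ->
  forall c A, sorted ltn c -> dense (2 ^ i) c -> subtree e A ->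
    size c = size A -> fits (2 ^ i) c -> place e c A.
Proof.
move=> esym eirr; elim: i => [|i IH] c A sc cu tA sz fc.
  have uc : uniq c by exact: sorted_uniq ltn_trans ltnn _ sc.
  have c1 : size c <= 1.
    case: fc => [|[k ck]]; first by lia.
    by apply: (@size_range k 1) => // p /ck; rewrite !expn0; lia.
  case: c A sz c1 {sc cu tA uc fc} => [|p []] // [|x []] //= _ _.
    by exists (fun=> 0); split.
  exists (fun=> p); split=> [y|y z|y z]; rewrite !inE //.
    by move=> /eqP-> /eqP->.
  by move=> /eqP-> /eqP->; rewrite eirr.
have cu2 : dense (2 ^ i).*2 c by rewrite -mul2n -expnS.
have [small|big] := leqP (size A) (3 * 2 ^ i).
  exact: place_narrow esym eirr IH sc cu2 tA sz small.
case: fc => [|[k ck]]; first by rewrite expnS; lia.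
apply: (place_wide (k := k) esym eirr _ sc cu2 tA sz big).
  by move=> d P sd dh tP szd P3; apply: IH => //; left; rewrite szd.
by move=> p /ck; rewrite expnS mul2n.
Qed.

(** * Universality of the host *)

Definition host (n : nat) : sgraph 'I_n :=
  @SGraph 'I_n (fun p q => near p q) (fun p q => near_sym p q)
    (fun p => near_irr p).

Lemma host_universal (n : nat) : tree_universal n (host n).
Proof.
split=> [|W T cardW treeT]; first exact: card_ord.
have [A tA pA] := tree_rtree treeT.
have WA x : x \in A by rewrite (perm_mem pA) mem_enum.
have szA : size A = n by rewrite (perm_size pA) -cardE.
(* Scale [2 ^ n] exceeds [n], so the full interval meets the first case of [fits]. *)
have [||//||f [fn fI fe]] := @place_subtree W (adj T) n (adj_sym T) (adj_irr T)
  (iota 0 n) A _ _ tA _ _.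
- exact: iota_ltn_sorted.
- move=> a b p _; rewrite !mem_iota => /andP[_ bn] /andP[_ pb] _.
  exact: leq_ltn_trans pb bn.
- by rewrite size_iota.
- left; rewrite size_iota; apply: leq_mul => //.
  by apply/ltnW/ltn_expl.
have fn' x : f x < n by have := fn x (WA x); rewrite mem_iota.
exists (fun x => Ordinal (fn' x)); split=> [x y [fxy]|x y Txy].
  exact: fI (WA x) (WA y) fxy.
exact: fe (WA x) (WA y) Txy.
Qed.

(** * Counting the edges *)

(** Each edge is charged to an end that reaches the other. *)
Lemma host_edges (n : nat) :
  num_edges (host n) <= \sum_(p < n) (reach p).*2.+1.
Proof.
pose win (p q : 'I_n) := (p <= q + reach p) && (q <= p + reach p).
rewrite /num_edges.
apply: (@leq_trans #|[set [set x.1; x.2] | x in [set x | win x.1 x.2]]|).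
  apply/subset_leq_card/subsetP=> E /imsetP[[p q]]; rewrite inE /= => /andP[_].
  move=> /orP[pq|qp] ->.
    by apply/imsetP; exists (p, q) => //; rewrite inE.
  by apply/imsetP; exists (q, p); rewrite ?inE 1?setUC // /win andbC.
apply: leq_trans (leq_imset_card _ _) _.
rewrite -sum1_card (eq_bigl (fun x => win x.1 x.2)); last by move=> x; rewrite inE.
rewrite -(pair_big_dep xpredT win (fun _ _ => 1)) /=.
apply: leq_sum => p _; rewrite sum1_card cardE -(size_map val).
apply: (@size_range (p - reach p)).
  by rewrite map_inj_uniq ?enum_uniq //; exact: val_inj.
move=> _ /mapP[q + ->]; rewrite mem_enum unfold_in /win /= => pq; lia.
Qed.

(** Equality holds for positive [p]; at [0] the junk value leaves [3 <= 6]. *)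
Lemma weight_double (p : nat) : weight p.*2 <= 2 * weight p.
Proof.
case: p => [//|p]; rewrite /weight -mul2n.
have -> : logn 2 (2 * p.+1) = (logn 2 p.+1).+1 by rewrite lognM // (pfactorK 1).
by rewrite expnS divnMl // mulnCA.
Qed.

(** Even positions cost at most twice the sum up to [m]; odd positions alternate between weights 3
    and 2, averaging [5/2]. *)
Lemma sum_weight_double (m : nat) :
  2 * \sum_(p < m.*2) weight p <= 4 * \sum_(p < m) weight p + 5 * m + odd m.
Proof.
elim: m => [|m IH]; first by rewrite !big_ord0.
rewrite doubleS !big_ord_recr /=.
have := weight_double m; have := weight_odd m 0; rewrite expn0 !muln1 => ->.
by move: IH; case: (odd m) => /=; lia.
Qed.

(** Induction by halving [n]. The terms [5 * L + 12] absorb the rounding in [uphalf n]; at [L = 0],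
    [n = 1] the bound is tight. *)
Lemma sum_weight (L n : nat) :
  n <= 2 ^ L ->
  4 * \sum_(p < n) weight p + 5 * L + 12 <= 5 * (n * L) + 24 * 2 ^ L.
Proof.
elim: L n => [|L IH] n nL.
  case: n nL => [|[|//]] _; first by rewrite big_ord0.
  by rewrite big_ord1 /weight logn0.
have n'L : uphalf n <= 2 ^ L by rewrite expnS in nL; lia.
have n2 : n <= (uphalf n).*2 by lia.
have mono : \sum_(p < n) weight p <= \sum_(p < (uphalf n).*2) weight p.
  by rewrite -(subnKC n2) big_split_ord leq_addr.
have := IH _ n'L; have := sum_weight_double (uphalf n).
have : uphalf n * L * 2 <= n * L + L.
  by rewrite -mulSnr mulnAC leq_mul2r; apply/orP; right; lia.
have : (uphalf n).*2 <= n.+1 by lia.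
rewrite expnS mulnS; move: mono; case: (odd _); lia.
Qed.

Lemma s_le (n : nat) : 0 < n -> 2 * s n <= 5 * (n * trunc_log 2 n) + 67 * n.
Proof.
move=> n0; have sn : s n <= num_edges (host n).
  rewrite /s; case: ex_minnP => m _; apply; apply/asboolP.
  by exists 'I_n, (host n); split=> //; exact: host_universal.
have /andP[kn nk] := trunc_log_bounds (isT : 1 < 2) n0.
have := sum_weight (ltnW nk).
have := leq_trans sn (host_edges n).
have -> : \sum_(p < n) (reach p).*2.+1 = 2 * (\sum_(p < n) weight p) + 7 * n.
  rewrite big_distrr /= -[n in 7 * n]card_ord -sum1_card big_distrr -big_split /=.
  by apply: eq_bigr => p _; rewrite /reach; lia.
(* With [L] one more than the logarithm, [67 = 5 + 48 + 14]: from [n * L], from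
   [24 * 2 ^ L <= 48 * n], and from twice [7 * n]. *)
move: kn; rewrite expnS mulnS; lia.
Qed.

(** * From binary to ternary logarithms *)

Local Open Scope ring_scope.

Theorem theorem2 (R : realType) :
  exists C : R, 0 < C /\
    forall n : nat, (1 <= n)%N ->
      (s n)%:R <= 14%:R / 3%:R * n%:R * log3 (n%:R : R) + C * n%:R.
Proof.
(* Half of the [67] in [s_le], rounded up. *)
exists 34%:R; split=> // n n1.
have n0 : 0 < n%:R :> R by rewrite ltr0n.
set k := trunc_log 2 n.
have l3 : 0 < ln 3%:R :> R by apply: ln_gt0; rewrite ltr1n.
have k_le : k%:R * ln 2%:R <= ln n%:R :> R.
  rewrite mulr_natl -lnXn ?ltr0n // -natrX ler_ln ?posrE ?ltr0n ?expn_gt0 //.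
  by rewrite ler_nat trunc_logP.
(* This is [3^5 = 243 <= 256 = 2^8]. *)
have l32 : 5%:R * ln 3%:R <= 8%:R * ln 2%:R :> R.
  rewrite !mulr_natl -!lnXn ?ltr0n // -!natrX ler_ln ?posrE ?ltr0n ?expn_gt0 //.
  by rewrite ler_nat.
have ln0 : 0 <= ln n%:R :> R by apply: ln_ge0; rewrite ler1n.
(* Equivalent to [(5/2) k <= (14/3) log3 n], the comparison of leading terms; [l32] even gives
   [35/2] in place of [15]. *)
have klog : 15%:R * k%:R <= 28%:R * log3 (n%:R : R).
  rewrite /log3 mulrA ler_pdivlMr //.
  by have := ler_wpM2l (ler0n R k) l32; lra.
have := s_le n1; rewrite -(ler_nat R) !natrD !natrM => sn.
have := ler_wpM2l (ltW n0) klog.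
rewrite -/k in sn *; lra.
Qed.
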